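(* Let $p$ be an odd prime with $p\equiv 1\pmod 3$ and let $n$ be an integer. Then $$\sum_{\chi \bmod p}|S_p(n;\chi)|^{2}=p^2+O(p^{3/2}),$$ where the sum runs over all Dirichlet characters $\chi$ modulo $p$.
   Context: Write $e(y)=e^{2\pi i y}$. For a Dirichlet character $\chi$ modulo $p$ and an integer $n$, the (weighted) Kummer sum is $S_p(n;\chi)=\sum_{a=1}^{p}\chi(a)\,e\!\left(\frac{na^3}{p}\right)$. The principal character $\chi_0$ modulo $p$ satisfies $\chi_0(a)=1$ if $\gcd(a,p)=1$ and $\chi_0(a)=0$ otherwise. The notation $f=O(g)$ means $|f|\le c\cdot g$ for an absolute constant $c$. *)

(* Defs.v *)
From mathcomp Require Export all_boot all_order all_algebra.
From mathcomp Require Export all_classical all_reals all_analysis.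
From mathcomp Require Export complex.

Set Implicit Arguments.
Unset Strict Implicit.
Unset Printing Implicit Defensive.

Import Order.TTheory GRing.Theory Num.Theory.

Local Open Scope classical_set_scope.
Local Open Scope ring_scope.
Local Open Scope complex_scope.

(* e(y) = exp (2 pi i y), written by Euler's formula because the library has
   no complex exponential *)
Definition e (R : realType) (y : R) : R[i] :=
  cos (2 * pi * y) +i* sin (2 * pi * y).

Definition is_dirichlet_character (R : realType) (q : nat)
    (chi : int -> R[i]) : Prop :=
  [/\ forall a : int, chi (a + q%:Z) = chi a,
      forall a b : int, chi (a * b) = chi a * chi b &
      forall a : int, (chi a != 0) = coprimez a q%:Z].

(* This set is finite for q > 0, so that a sum [\sum_(chi \in _) _] over it is
   the usual finite sum (such a sum is 0 by convention on infinite supports). *)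
Definition dirichlet_characters (R : realType) (q : nat) : set (int -> R[i]) :=
  [set chi | is_dirichlet_character q chi].
Arguments dirichlet_characters : clear implicits.

Definition kummer_sum (R : realType) (p : nat) (n : int)
    (chi : int -> R[i]) : R[i] :=
  \sum_(1 <= a < p.+1) chi a%:Z * e (n%:~R * a%:R ^+ 3 / p%:R).

(* Main.v *)
Require Import Defs.
From mathcomp Require Import all_boot all_order all_algebra.
From mathcomp Require Import all_classical all_reals all_analysis.
From mathcomp Require Import complex.
From mathcomp Require Import cyclic separable finfield cyclotomic.
From mathcomp Require Import ring lra.

(** The mean square can be computed exactly: it is [(p - 1) ^+ 2], whatever the
    integer [n], and [(p - 1) ^+ 2 - p ^+ 2 = 1 - 2 * p] is already [O(p)].

    Expanding [|S_p(n; chi)|^2] and summing over all [chi] first, orthogonality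
    of characters keeps only the diagonal terms, those with [a = b] modulo [p].
    On the diagonal the factors [e(n a^3 / p)] and [e(- n a^3 / p)] cancel, so
    that each of the [p - 1] units contributes [p - 1], the number of
    characters.  The same cancellation computes the mean square of the sums of
    [chi(a) w(a)] for any weights [w] ([parseval_dirichlet_characters]); the
    weights of a Kummer sum all have modulus 1.

    Orthogonality is obtained by making the character group explicit.  Fix a
    generator [g] of the units of ['F_p] and a primitive [(p - 1)]-th root of
    unity [z] in the complex numbers.  A character is determined by its value
    at [g], which is a power of [z], so the characters are exactly the functions
    [g ^+ j |-> z ^+ (k * j)] for [k < p - 1]
    ([sum_dirichlet_characters_index]).  In the variable [j], a sum of
    [chi(a) w(a)] over the units becomes a discrete Fourier transform of length
    [p - 1], and the claim becomes the Parseval identity for it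
    ([parseval_prim_root]). *)

Set Implicit Arguments.
Unset Strict Implicit.

Import Order.TTheory GRing.Theory Num.Theory.

Local Open Scope classical_set_scope.
Local Open Scope ring_scope.

(** * The discrete Fourier transform *)

(** In characteristic 0 the polynomial ['X^m - 1] is separable, so it has [m]
    distinct roots, and a finite group of roots of unity is cyclic. *)
Lemma numClosedField_prim_root (C : numClosedFieldType) (m : nat) :
  (0 < m)%N -> exists z : C, m.-primitive_root z.
Proof.
move=> m_gt0; have [r Dr] := closed_field_poly_normal ('X^m - 1 : {poly C}).
rewrite (monicP _) ?monicXnsubC // scale1r in Dr.
suff /hasP[z _ z_prim] : has m.-primitive_root r by exists z.
apply: has_prim_root => //.
- by apply/allP=> z; rewrite -root_prod_XsubC -Dr.
- by rewrite -separable_prod_XsubC -Dr separable_Xn_sub_1 // pnatr_eq0 -lt0n.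
- by rewrite -ltnS -(size_prod_XsubC r id) -Dr size_XnsubC.
Qed.

Lemma prim_root_neq0 (F : fieldType) (m : nat) (u : F) :
  m.-primitive_root u -> u != 0.
Proof.
by move=> u_prim; rewrite (prim_root_eq0 u_prim) -lt0n (prim_order_gt0 u_prim).
Qed.

(** The orthogonality relation behind Parseval: for [u != 1] the geometric sum
    is [(u ^+ m - 1) / (u - 1)]. *)
Lemma sum_expr_unity_root (F : fieldType) (m : nat) (u : F) :
  u ^+ m = 1 -> \sum_(k < m) u ^+ k = if u == 1 then m%:R else 0.
Proof.
move=> um1; case: eqP => [->|/eqP u_neq1].
  under eq_bigr do rewrite expr1n.
  by rewrite sumr_const card_ord.
by apply: (mulfI (x := u - 1)); rewrite ?subr_eq0 // -subrX1 um1 subrr mulr0.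
Qed.

(** Parseval for the Fourier transform on [Z/m].  As [z] has modulus 1, its
    conjugate is its inverse, and after expanding the square the sum over [k]
    at the pair [(i, j)] is the geometric sum of ratio [z ^+ i / z ^+ j], which
    vanishes off the diagonal. *)
Lemma parseval_prim_root (C : numClosedFieldType) (m : nat) (z : C)
    (w : 'I_m -> C) : m.-primitive_root z ->
  \sum_(k < m) `|\sum_(j < m) z ^+ (k * j) * w j| ^+ 2 =
    m%:R * \sum_(j < m) `|w j| ^+ 2.
Proof.
move=> z_prim; have m_gt0 := prim_order_gt0 z_prim.
have zm1 := prim_expr_order z_prim.
have z_neq0 := prim_root_neq0 z_prim.
have z_norm : `|z| = 1.
  by apply/eqP; rewrite -(pexpr_eq1 m_gt0) ?normr_ge0 // -normrX zm1 normr1.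
have conjz : z^* = z^-1.
  by apply: (mulfI z_neq0); rewrite -normCK z_norm expr1n divff.
transitivity (\sum_(i < m) \sum_(j < m)
    (\sum_(k < m) (z ^+ i / z ^+ j) ^+ k) * (w i * (w j)^*)).
  under eq_bigr => k _.
    rewrite normCK rmorph_sum mulr_suml.
    under eq_bigr => i _ do rewrite mulr_sumr.
    over.
  rewrite exchange_big; apply: eq_bigr => i _ /=.
  rewrite exchange_big; apply: eq_bigr => j _ /=.
  rewrite mulr_suml; apply: eq_bigr => k _.
  rewrite rmorphM rmorphXn /= conjz mulrACA; congr (_ * _).
  by rewrite exprMn !exprVn -!exprM ![(k * _)%N]mulnC.
rewrite mulr_sumr; apply: eq_bigr => i _.
rewrite (bigD1 i) //= [X in _ + X]big1 ?addr0 => [|j j_neq_i].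
  rewrite divff ?expf_neq0 // normCK; congr (_ * _).
  by rewrite sum_expr_unity_root ?expr1n // eqxx.
rewrite sum_expr_unity_root; last first.
  by rewrite exprMn !exprVn -!exprM ![(_ * m)%N]mulnC !exprM zm1 !expr1n divr1.
rewrite -subr_eq0 -[X in _ - X](divff (expf_neq0 j z_neq0)) -mulrBl mulf_eq0.
rewrite invr_eq0 (negPf (expf_neq0 _ z_neq0)) orbF subr_eq0.
rewrite (eq_prim_root_expr z_prim) !modn_small //.
by rewrite eq_sym (inj_eq val_inj) (negPf j_neq_i) mul0r.
Qed.

(** * Units of the prime field *)

Lemma Fp_expr_pred (p : nat) (x : 'F_p) : prime p -> x != 0 -> x ^+ p.-1 = 1.
Proof.
move=> p_pr x_neq0; apply: (mulfI x_neq0).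
by rewrite mulr1 -exprS prednK ?prime_gt0 // -[RHS]expf_card card_Fp.
Qed.

(** The [p - 1] nonzero elements of ['F_p] are roots of ['X^(p-1) - 1], as many
    as this polynomial can have, which forces a primitive one among them. *)
Lemma Fp_prim_root (p : nat) : prime p -> exists g : 'F_p, p.-1.-primitive_root g.
Proof.
move=> p_pr; have p1_gt0 : (0 < p.-1)%N by rewrite -subn1 subn_gt0 prime_gt1.
pose r := [seq x <- enum 'F_p | x != 0].
suff /hasP[g _ g_prim] : has p.-1.-primitive_root r by exists g.
apply: has_prim_root => //.
- apply/allP=> x; rewrite mem_filter => /andP[x_neq0 _].
  by rewrite unity_rootE Fp_expr_pred.
- by rewrite filter_uniq ?enum_uniq.
- (* [0] occurs once in the enumeration of the [p] elements. *)
  rewrite size_filter -(leq_add2l (count (pred1 0) (enum 'F_p))) count_predC.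
  rewrite -cardE card_Fp // (count_uniq_mem _ (enum_uniq _)).
  by rewrite mem_enum add1n prednK ?prime_gt0.
Qed.

Lemma intr_natr_Fp (p : nat) (x : 'F_p) : ((x : nat)%:Z)%:~R = x.
Proof. by rewrite -[RHS]natr_Zp. Qed.

Lemma coprimez_Fp (p : nat) (a : int) :
  prime p -> coprimez a p%:Z = (a%:~R != 0 :> 'F_p).
Proof.
move=> p_pr; rewrite -(dvdz_pcharf (pchar_Fp p_pr)) coprimez_sym coprimezE.
by rewrite prime_coprime // dvdzE.
Qed.

(** * Dirichlet characters to a prime modulus *)

Section PrimeModulus.

Variables (R : realType) (p : nat).
Hypothesis p_pr : prime p.
Variables (g : 'F_p) (z : R[i]).
Hypotheses (g_prim : p.-1.-primitive_root g) (z_prim : p.-1.-primitive_root z).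

Lemma Fp_expr_generator (x : 'F_p) : x != 0 -> exists j : 'I_p.-1, x = g ^+ j.
Proof.
move=> x_neq0.
by have [j ->] := prim_rootP g_prim (Fp_expr_pred p_pr x_neq0); exists j.
Qed.

Lemma generator_expr_neq0 (j : nat) : g ^+ j != 0.
Proof.
exact: expf_neq0 (prim_root_neq0 g_prim).
Qed.

(** Reindexing the units by the discrete logarithm: the representatives of
    [g ^+ j] in the range from 1 to [p - 1] are [p - 1] distinct numbers. *)
Lemma sum_units_generator (V : nmodType) (F : nat -> V) :
  \sum_(1 <= a < p) F a = \sum_(j < p.-1) F (g ^+ j : nat).
Proof.
pose s := [seq (g ^+ nat_of_ord j : 'F_p) : nat | j <- enum 'I_p.-1].
have s_uniq : uniq s.
  rewrite map_inj_uniq ?enum_uniq // => i j /val_inj/eqP.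
  by rewrite (eq_prim_root_expr g_prim) !modn_small // => /eqP/val_inj.
have s_sub : {subset s <= index_iota 1 p}.
  move=> _ /mapP[j _ ->]; rewrite mem_index_iota lt0n.
  have := ltn_ord (g ^+ j); rewrite [X in (_ < X)%N -> _]Fp_cast // => ->.
  rewrite andbT; apply: contraNneq (generator_expr_neq0 j) => gj0.
  exact/eqP/val_inj.
have /(uniq_min_size s_uniq s_sub)[_ s_mem] : (size (index_iota 1 p) <= size s)%N.
  by rewrite size_iota size_map -cardE card_ord subn1.
rewrite -(perm_big _ (uniq_perm s_uniq (iota_uniq _ _) s_mem)) /=.
by rewrite big_map big_enum.
Qed.

(** The character sending [g] to [z ^+ k].  The sum has one term when [p] does
    not divide [a], its index being the discrete logarithm of [a], and no term
    otherwise; this gives the value 0 at multiples of [p] without a case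
    distinction. *)
Definition index_character (k : nat) (a : int) : R[i] :=
  \sum_(j < p.-1 | g ^+ j == a%:~R) z ^+ (k * j).

(** The exponent [j] may be any natural number, not only the reduced one, so
    that the product of two units is handled by adding exponents. *)
Lemma index_characterE (k j : nat) (a : int) :
  a%:~R = g ^+ j -> index_character k a = z ^+ (k * j).
Proof.
move=> Da; have lt_j := ltn_pmod j (prim_order_gt0 g_prim).
rewrite /index_character (big_pred1 (Ordinal lt_j)) /= => [|i].
  by rewrite -(prim_expr_mod z_prim) modnMmr prim_expr_mod.
rewrite Da (eq_prim_root_expr g_prim) modn_small //.
Qed.

Lemma index_character_eq0 (k : nat) (a : int) :
  a%:~R = 0 :> 'F_p -> index_character k a = 0.
Proof.
by move=> Da; apply: big_pred0 => j; rewrite Da (negPf (generator_expr_neq0 j)).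
Qed.

Lemma index_character_dirichlet (k : nat) :
  is_dirichlet_character p (index_character k).
Proof.
split=> [a|a b|a].
- rewrite /index_character rmorphD /=.
  by rewrite [X in _ + X](_ : _ = 0) ?addr0 //; exact: pcharf0 (pchar_Fp p_pr).
- have [a0|/Fp_expr_generator[i Da]] := eqVneq (a%:~R : 'F_p) 0.
    rewrite (index_character_eq0 _ a0) mul0r index_character_eq0 //.
    by rewrite rmorphM /= a0 mul0r.
  have [b0|/Fp_expr_generator[j Db]] := eqVneq (b%:~R : 'F_p) 0.
    rewrite (index_character_eq0 _ b0) mulr0 index_character_eq0 //.
    by rewrite rmorphM /= b0 mulr0.
  rewrite (index_characterE _ Da) (index_characterE _ Db).
  rewrite (index_characterE _ (j := (i + j)%N)); last first.
    by rewrite rmorphM /= Da Db exprD.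
  by rewrite mulnDr exprD.
- rewrite coprimez_Fp //.
  have [a0|/Fp_expr_generator[i Da]] := eqVneq (a%:~R : 'F_p) 0.
    by rewrite index_character_eq0 ?eqxx.
  rewrite (index_characterE _ Da) expf_neq0 //.
  exact: prim_root_neq0 z_prim.
Qed.

(** Periodicity is only assumed for a shift by [+p]; iterating it, in either
    direction, makes a character a function on ['F_p]. *)
Lemma dirichlet_character_Fp (chi : int -> R[i]) (a b : int) :
  is_dirichlet_character p chi -> a%:~R = b%:~R :> 'F_p -> chi a = chi b.
Proof.
case=> chiD _ _ eq_ab.
have chi_nat (c : int) (n : nat) : chi (c + n%:Z * p%:Z) = chi c.
  elim: n => [|n IHn]; first by rewrite mul0r addr0.
  by rewrite -addn1 PoszD mulrDl mul1r addrA chiD.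
have /dvdzP[q Dq] : (p %| a - b)%Z.
  by rewrite (dvdz_pcharf (pchar_Fp p_pr)) rmorphB /= eq_ab subrr.
have {Dq} Da : a = b + q * p%:Z by rewrite -Dq addrC subrK.
case: q Da => n Da; first by rewrite Da chi_nat.
by rewrite -(chi_nat a n.+1) Da NegzE mulNr subrK.
Qed.

(** Since [g ^+ (p - 1) = 1], the value of a character at [g] is a
    [(p - 1)]-th root of unity, hence [z ^+ k] for some [k]; multiplicativity
    then determines it at every power of [g]. *)
Lemma dirichlet_character_index (chi : int -> R[i]) :
  is_dirichlet_character p chi ->
  exists k : 'I_p.-1, chi = index_character k.
Proof.
move=> chi_dir; have [_ chiM chi_neq0] := chi_dir.
have chi1 : chi 1 = 1.
  have chi1_neq0 : chi 1 != 0 by rewrite chi_neq0 coprimezE coprime1n.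
  by apply: (mulfI chi1_neq0); rewrite mulr1 -chiM mulr1.
have chiX (a : int) (j : nat) : chi (a ^+ j) = chi a ^+ j.
  by elim: j => // j IHj; rewrite !exprS chiM IHj.
pose G : int := (g : nat)%:Z.
have GX (j : nat) : (G ^+ j)%:~R = g ^+ j by rewrite rmorphXn /= intr_natr_Fp.
have chiG_unity : chi G ^+ p.-1 = 1.
  rewrite -chiX -chi1; apply: dirichlet_character_Fp chi_dir _.
  by rewrite GX prim_expr_order.
have [k DchiG] := prim_rootP z_prim chiG_unity.
exists k; apply/funext=> a.
have [a0|/Fp_expr_generator[j Da]] := eqVneq (a%:~R : 'F_p) 0.
  rewrite index_character_eq0 //; apply/eqP; apply/negPn.
  by rewrite chi_neq0 coprimez_Fp // a0 eqxx.
rewrite (index_characterE _ Da) exprM -DchiG -chiX.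
by apply: dirichlet_character_Fp chi_dir _; rewrite GX.
Qed.

Lemma index_character_inj :
  injective (fun k : 'I_p.-1 => index_character k).
Proof.
move=> k l /(congr1 (@^~ (g : nat)%:Z)) /=.
rewrite !(@index_characterE _ 1%N) ?intr_natr_Fp // !muln1 => /eqP.
by rewrite (eq_prim_root_expr z_prim) !modn_small // => /eqP/val_inj.
Qed.

(** The map from [k] to [index_character k] is a bijection from the indices
    below [p - 1] onto the set of characters, which is therefore finite: the sum
    over this set is a genuine one. *)
Lemma sum_dirichlet_characters_index (V : nmodType) (F : (int -> R[i]) -> V) :
  \sum_(chi \in dirichlet_characters R p) F chi =
    \sum_(k < p.-1) F (index_character k).
Proof.
pose r := [seq index_character (nat_of_ord k) | k <- enum 'I_p.-1].
have r_uniq : uniq r.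
  by rewrite map_inj_uniq ?enum_uniq //; exact: index_character_inj.
rewrite (_ : dirichlet_characters R p = [set` r]).
  by rewrite -fsbig_seq // big_map big_enum.
apply/seteqP; split=> [chi /dirichlet_character_index[k ->]|chi /mapP[k _ ->]].
  by apply/mapP; exists k; rewrite ?mem_enum.
exact: index_character_dirichlet.
Qed.

End PrimeModulus.

(** * Mean squares over the character group *)

(** Passes from the real-valued modulus to the complex-valued norm, for which
    the ring theory of conjugation is available. *)
Lemma sqr_normc_normr (R : realType) (x : R[i]) :
  ((Normc.normc x ^+ 2)%:C)%C = `|x| ^+ 2.
Proof. by rewrite rmorphXn. Qed.

(** In terms of the discrete logarithm [j], the inner sum for the [k]-th
    character is the [k]-th Fourier coefficient of [j |-> w (g ^+ j)]. *)
Theorem parseval_dirichlet_characters (R : realType) (p : nat) (w : nat -> R[i]) :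
  prime p ->
  \sum_(chi \in dirichlet_characters R p)
     Normc.normc (\sum_(1 <= a < p) chi a%:Z * w a) ^+ 2 =
  (p.-1)%:R * \sum_(1 <= a < p) Normc.normc (w a) ^+ 2.
Proof.
move=> p_pr; have p1_gt0 : (0 < p.-1)%N by rewrite -subn1 subn_gt0 prime_gt1.
have [g g_prim] := Fp_prim_root p_pr.
have [z z_prim] := numClosedField_prim_root R[i] p1_gt0.
rewrite (sum_dirichlet_characters_index p_pr g_prim z_prim).
apply: (@complexI R); rewrite rmorphM rmorph_nat !rmorph_sum /=.
under [in RHS]eq_bigr do rewrite sqr_normc_normr.
rewrite (sum_units_generator p_pr g_prim) -(parseval_prim_root _ z_prim).
apply: eq_bigr => k _; rewrite sqr_normc_normr (sum_units_generator p_pr g_prim).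
congr (`| _ | ^+ 2); apply: eq_bigr => j _.
by rewrite (index_characterE g_prim z_prim _ (j := j)) ?intr_natr_Fp.
Qed.

Lemma normc_e (R : realType) (y : R) : Normc.normc (e y) = 1.
Proof. by rewrite /e /= cos2Dsin2 sqrtr1. Qed.

(** The term [a = p] drops out because characters vanish at [p]. *)
Lemma kummer_sum_units (R : realType) (p : nat) (n : int) (chi : int -> R[i]) :
  prime p -> is_dirichlet_character p chi ->
  kummer_sum p n chi =
    \sum_(1 <= a < p) chi a%:Z * e (n%:~R * a%:R ^+ 3 / p%:R).
Proof.
move=> p_pr [_ _ chi_neq0]; rewrite /kummer_sum big_nat_recr ?prime_gt0 //=.
rewrite (_ : chi p%:Z = 0) ?mul0r ?addr0 //; apply/eqP/negPn.
by rewrite chi_neq0 coprimezE /coprime gcdnn gtn_eqF ?prime_gt1.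
Qed.

(** All weights [e(n a^3 / p)] have modulus 1, so Parseval returns the number of
    characters times the number of units. *)
Theorem sum_sqr_kummer_sum (R : realType) (p : nat) (n : int) :
  prime p ->
  \sum_(chi \in dirichlet_characters R p)
     Normc.normc (kummer_sum p n chi) ^+ 2 = (p%:R - 1) ^+ 2.
Proof.
move=> p_pr.
under eq_fsbigr => chi /set_mem chi_dir do rewrite (kummer_sum_units n p_pr chi_dir).
rewrite parseval_dirichlet_characters //.
under eq_bigr do rewrite normc_e expr1n.
by rewrite sumr_const_nat subn1 -expr2 -subn1 natrB ?prime_gt0.
Qed.

Unset Implicit Arguments.

Theorem theorem1p2 (R : realType) :
  exists c : R, forall (p : nat) (n : int),
    prime p -> odd p -> p = 1 %[mod 3] ->
    `| \sum_(chi \in dirichlet_characters R p)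
         Normc.normc (kummer_sum p n chi) ^+ 2 - p%:R ^+ 2 |
      <= c * p%:R `^ (3 / 2).
Proof.
(* [|(p - 1)^2 - p^2| = 2 p - 1], and [p <= p^(3/2)]. *)
exists 2 => p n p_pr _ _; rewrite sum_sqr_kummer_sum //.
have p_ge1 : 1 <= p%:R :> R by rewrite ler1n prime_gt0.
have p_le : p%:R <= p%:R `^ (3 / 2) :> R.
  by rewrite -[leLHS]powRr1 ?ler0n // ler_powR //; lra.
have -> : (p%:R - 1) ^+ 2 - p%:R ^+ 2 = - (2 * p%:R - 1) :> R by ring.
rewrite normrN ger0_norm; lra.
Qed.
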